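(* Let $X$ be a perfectly normal topological space and let $A\subset X$ be a nonempty subset which is both an $F_\sigma$ and a $G_\delta$ subset of $X$. Then there exists a linear operator $\varphi^\star\colon \mathfrak{fcBor}(A,\mathbb{R})\to\mathfrak{fcBor}(X,\mathbb{R})$ such that: (i) $\varphi^\star$ is an extension operator, i.e. $\varphi^\star(f)|_A=f$ for every $f\in\mathfrak{fcBor}(A,\mathbb{R})$; (ii) $\varphi^\star$ is non-negative, i.e. $f\geq 0$ on $A$ implies $\varphi^\star(f)\geq 0$ on $X$; (iii) $\varphi^\star$ preserves unity, i.e. $\varphi^\star(1_A)=1_X$, where $1_A$ and $1_X$ are the constant functions equal to $1$ on $A$ and on $X$; (iv) the restriction of $\varphi^\star$ to $\mathfrak{fcBor}^b(A,\mathbb{R})$ is an isometry with respect to supremum norms, i.e. $\|\varphi^\star(f)\|_X=\|f\|_A$ for every $f\in\mathfrak{fcBor}^b(A,\mathbb{R})$.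
   Context: All spaces are Hausdorff. A space is perfectly normal if it is normal and each of its open subsets is $F_\sigma$ (a countable union of closed sets). For topological spaces $Z,Y$, a function $f\colon Z\to Y$ is of the first Borel class if $f^{-1}(U)$ is an $F_\sigma$ subset of $Z$ for every open $U\subset Y$; $\mathfrak{fcBor}(Z,Y)$ denotes the family of all such functions. A subset $A\subset X$ carries the subspace topology. $\mathfrak{fcBor}(Z,\mathbb{R})$ is a vector space under pointwise operations. $\mathfrak{fcBor}^b(Z,\mathbb{R})$ denotes the bounded elements of $\mathfrak{fcBor}(Z,\mathbb{R})$, with supremum norm $\|f\|_Z=\sup_{z\in Z}|f(z)|$. *)

(* Defs.v *)
From HB Require Import structures.
From mathcomp Require Import all_boot all_order all_algebra.
From mathcomp Require Import all_classical all_reals all_analysis borel_hierarchy.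

Set Implicit Arguments.
Unset Strict Implicit.
Unset Printing Implicit Defensive.

Import Order.TTheory GRing.Theory Num.Theory.
Import numFieldNormedType.Exports.

Local Open Scope classical_set_scope.
Local Open Scope ring_scope.

(* Neither [normal_space] nor this definition includes the Hausdorff axiom. *)
Definition perfectly_normal_space (X : topologicalType) : Prop :=
  normal_space X /\ forall U : set X, open U -> Fsigma U.

Definition first_Borel_class (Z Y : topologicalType) (f : Z -> Y) : Prop :=
  forall U : set Y, open U -> Fsigma (f @^-1` U).

Definition fcBor_pred (Z Y : topologicalType) : {pred Z -> Y} :=
  mem [set f : Z -> Y | first_Borel_class f].

Record fcBor (Z Y : topologicalType) := FcBor {
  fcBor_fun :> Z -> Y;
  fcBorP : fcBor_fun \in @fcBor_pred Z Y }.

HB.instance Definition _ (Z Y : topologicalType) :=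
  [isSub of fcBor Z Y for @fcBor_fun Z Y].
HB.instance Definition _ (Z Y : topologicalType) := [Choice of fcBor Z Y by <:].

Section Fsigma_closure.
Context {T : topologicalType}.

Lemma Fsigma_bigcup (I : countType) (F : I -> set T) :
  (forall i, Fsigma (F i)) -> Fsigma (\bigcup_i F i).
Proof.
move=> FF.
have /choice[H HP] : forall i, exists G : (set T)^nat,
    (forall k, closed (G k)) /\ F i = \bigcup_k G k.
  by move=> i; have [G cG ->] := FF i; exists G.
exists (fun n => if unpickle n is Some p then H p.1 p.2 else set0).
  move=> n; case: unpickle => [[i k]|]; last exact: closed0.
  by have [cH _] := HP i; exact: cH.
rewrite eqEsubset; split=> [x [i _]|x [n _]].
  have [_ ->] := HP i; move=> [k _ Hx].
  by exists (pickle (i, k)) => //; rewrite pickleK.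
case: unpickle => [[i k]/= Hx|//]; exists i => //.
by have [_ ->] := HP i; exists k.
Qed.

Lemma Fsigma_setI (A B : set T) : Fsigma A -> Fsigma B -> Fsigma (A `&` B).
Proof.
move=> [F cF ->] [G cG ->].
have -> : (\bigcup_i F i) `&` (\bigcup_i G i) =
    \bigcup_(p : nat * nat) (F p.1 `&` G p.2).
  rewrite eqEsubset; split=> [x [[i _ Fx] [j _ Gx]]|x [[i j] _ [/= Fx Gx]]].
    by exists (i, j).
  by split; [exists i|exists j].
by apply: Fsigma_bigcup => p; apply: closed_Fsigma; exact: closedI.
Qed.

End Fsigma_closure.

Lemma first_Borel_class_cst (Z Y : topologicalType) (y : Y) :
  first_Borel_class (cst y : Z -> Y).
Proof.
move=> U _; rewrite preimage_cst; case: ifP => _; apply: closed_Fsigma.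
  exact: closedT.
exact: closed0.
Qed.

Definition fcBor_cst (Z Y : topologicalType) (y : Y) : fcBor Z Y :=
  FcBor (mem_set (@first_Borel_class_cst Z Y y)).

Section fcBor_lmodType.
Context (Z : topologicalType) (R : realType).
Implicit Types f g : Z -> R.

Lemma first_Borel_classD f g : first_Borel_class f -> first_Borel_class g ->
  first_Borel_class (f + g).
Proof.
move=> fB gB U oU.
pose V (p : rat * nat) : set R := ball (ratr p.1 : R) p.2.+1%:R^-1.
pose P (p : (rat * nat) * (rat * nat)) : Prop :=
  forall x y, V p.1 x -> V p.2 y -> U (x + y).
have oV p : open (V p) by exact: ball_open.
have approx (x : R) (e : R) : 0 < e ->
    exists p, V p x /\ forall x', V p x' -> `|x - x'| < e.
  move=> e0.
  have /ltr_add_invr[n] : 0 < e / 2 by rewrite divr_gt0.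
  rewrite add0r => ne; set d : R := n.+1%:R^-1 in ne.
  have d0 : 0 < d by rewrite invr_gt0 ltr0n.
  have [|q] := @rat_in_itvoo R (x - d) (x + d).
    by rewrite ltrD2l gtrN.
  rewrite in_itv /= => /andP[q1 q2].
  have qx : `|ratr q - x| < d.
    by rewrite ltr_norml ltrBrDl q1 ltrBlDl q2.
  exists (q, n); split=> // x' Vx'.
  rewrite (splitr e) (le_lt_trans (ler_distD (ratr q) _ _))// ltrD//.
    by rewrite distrC (lt_trans qx).
  by rewrite (lt_trans _ ne).
have -> : (f + g) @^-1` U =
    \bigcup_(p : (rat * nat) * (rat * nat))
      (if `[< P p >] then f @^-1` V p.1 `&` g @^-1` V p.2 else set0).
  rewrite eqEsubset; split=> [z /= Uz|z [p _]]; last first.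
    by case: asboolP => // Pp [/= fz gz]; exact: Pp.
  move: oU; rewrite openE => /(_ _ Uz); rewrite /interior => /nbhs_ballP[e /= e0 eU].
  have e20 : 0 < e / 2 by rewrite divr_gt0.
  have [p [pf pP]] := approx (f z) _ e20.
  have [q [qg qP]] := approx (g z) _ e20.
  exists (p, q) => //; case: asboolP => // -[] x y /= Vx Vy; apply: eU.
  rewrite /ball /= (_ : f z + g z - (x + y) = (f z - x) + (g z - y)).
    by rewrite (splitr e) (le_lt_trans (ler_normD _ _))// ltrD// ?pP ?qP.
  by rewrite opprD addrACA.
apply: Fsigma_bigcup => p; case: ifP => _; last exact/closed_Fsigma/closed0.
by apply: Fsigma_setI; [exact: fB|exact: gB].
Qed.

Lemma first_Borel_classZ (a : R) f :
  first_Borel_class f -> first_Borel_class (a *: f).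
Proof.
move=> fB U oU; rewrite (_ : _ @^-1` U = f @^-1` ((fun x : R => a * x) @^-1` U))//.
apply: fB; apply: open_comp => // x _; exact: mulrl_continuous.
Qed.

Lemma fcBor_submod_closed : submod_closed (@fcBor_pred Z R).
Proof.
split; first by rewrite inE; exact: first_Borel_class_cst.
move=> a f g; rewrite !inE => fB gB.
by apply: first_Borel_classD => //; exact: first_Borel_classZ.
Qed.

HB.instance Definition _ :=
  GRing.isSubmodClosed.Build R (Z -> R) (@fcBor_pred Z R) fcBor_submod_closed.
HB.instance Definition _ := [SubChoice_isSubLmodule of fcBor Z R by <:].

End fcBor_lmodType.

(* A genuine norm only on bounded functions: [sup] is [0] on unbounded sets. *)
Definition sup_norm (Z : Type) (R : realType) (f : Z -> R) : R :=
  sup (range (fun z => `|f z|)).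

(* Main.v *)
(* Fix a point a0 of A and let r : X -> A be the identity on A and a0 off A.
   Since both A and its complement are Fsigma in X, r pulls Fsigma sets back to
   Fsigma sets, so f |-> f \o r is the required operator: it is linear, and it
   preserves the range of f because r is onto. *)
Require Import Defs.
From HB Require Import structures.
From mathcomp Require Import all_boot all_order all_algebra.
From mathcomp Require Import all_classical all_reals all_analysis borel_hierarchy.

Import Order.TTheory GRing.Theory Num.Theory.
Import numFieldNormedType.Exports.

Local Open Scope classical_set_scope.
Local Open Scope ring_scope.

(** The topology on [A] is initial for [set_val], so opens of [A] are preimages of opens of [X] by
    definition; taking complements gives the closed case. *)
Lemma closed_subtypeP (X : topologicalType) (A : set X) (C : set A) :
  closed C -> exists2 D : set X, closed D & C = set_val @^-1` D.
Proof.
move=> cC.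
have : open (~` C) by rewrite openC.
case=> D oD DC; exists (~` D); first by rewrite closedC.
by rewrite -[C]setCK -DC.
Qed.

Lemma Fsigma_setC_Gdelta (X : topologicalType) (A : set X) :
  Gdelta A -> Fsigma (~` A).
Proof.
case=> G oG ->; rewrite setC_bigcap.
by exists (fun i => ~` G i) => // i; rewrite closedC.
Qed.

Lemma Fsigma_setU (X : topologicalType) (A B : set X) :
  Fsigma A -> Fsigma B -> Fsigma (A `|` B).
Proof.
move=> FA FB; rewrite (_ : A `|` B = \bigcup_(b : bool) if b then A else B).
  by apply: Fsigma_bigcup => -[].
by apply/seteqP; split=> x [];
  [exists true|exists false|move=> [] _; [left|right]].
Qed.

Section retraction.
Context (X : topologicalType) (A : set X) (a0 : A).
Hypotheses (A_Fsigma : Fsigma A) (A_Gdelta : Gdelta A).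

Let r (x : X) : A := insubd a0 x.

Lemma Fsigma_preimage_retraction (C : set A) : Fsigma C -> Fsigma (r @^-1` C).
Proof.
case=> F cF ->; rewrite preimage_bigcup; apply: Fsigma_bigcup => i.
have [D cD ->] := closed_subtypeP _ _ _ (cF i).
(* On [A] the map [r] is the identity, which contributes [A]&[D]; all of [~] A[goes to]a0[, so it is
   included entirely or not at all.]A_Gdelta[makes]~[A] an Fsigma set. *)
rewrite (_ : _ @^-1` _ =
    (A `&` D) `|` (if a0 \in set_val @^-1` D then ~` A else set0)).
  apply: Fsigma_setU; first exact: Fsigma_setI A_Fsigma (closed_Fsigma cD).
  case: ifP => _; first exact: Fsigma_setC_Gdelta.
  exact/closed_Fsigma/closed0.
apply/seteqP; split=> x /=.
  rewrite /r set_valE val_insubd; case: ifPn => [/set_mem Ax Dx|nAx Da0]; first by left.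
  by right; rewrite mem_set//= => Ax; rewrite mem_set in nAx.
rewrite /r set_valE val_insubd => -[[Ax Dx]|]; first by rewrite mem_set.
by case: ifPn => // /set_mem /= Da0 nAx; rewrite memNset.
Qed.

Lemma first_Borel_class_retraction (Y : topologicalType) (f : fcBor A Y) :
  first_Borel_class (f \o r).
Proof.
move=> U oU; rewrite comp_preimage; apply: Fsigma_preimage_retraction.
by have /set_mem := fcBorP f; exact.
Qed.

Definition retract_ext (Y : topologicalType) (f : fcBor A Y) : fcBor X Y :=
  FcBor (mem_set (first_Borel_class_retraction _ f)).

(** Precomposition with [r] commutes with pointwise operations by computation; only the membership
    proofs differ, and [val_inj] discards them. *)
Lemma retract_ext_linear (R : realType) : linear (@retract_ext R).
Proof. by move=> a f g; apply: val_inj. Qed.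

HB.instance Definition _ (R : realType) :=
  GRing.isLinear.Build R (fcBor A R) (fcBor X R) _ (@retract_ext R)
    (retract_ext_linear R).

End retraction.

Theorem theorem2 (R : realType) (X : topologicalType) (A : set X)
    (X_hausdorff : hausdorff_space X)
    (X_perfectly_normal : perfectly_normal_space X)
    (A_nonempty : A !=set0) (A_Fsigma : Fsigma A) (A_Gdelta : Gdelta A) :
  exists phi : {linear fcBor A R -> fcBor X R},
    [/\ forall (f : fcBor A R) (a : A), phi f (set_val a) = f a,
        forall f : fcBor A R,
          (forall a : A, 0 <= f a) -> forall x : X, 0 <= phi f x,
        phi (fcBor_cst A (1 : R)) = fcBor_cst X (1 : R) &
        forall f : fcBor A R, [bounded f a | a in [set: A]] ->
          [bounded phi f x | x in [set: X]] /\ sup_norm (phi f) = sup_norm f].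
Proof.
have [x0 /mem_set Ax0] := A_nonempty; pose a0 : A := SigSub Ax0.
exists (retract_ext _ _ a0 A_Fsigma A_Gdelta R : {linear _ -> _}).
split=> [f a|f f0 x||f [M [Mreal fM]]] /=.
- by rewrite valKd.
- exact: f0.
- exact: val_inj.
split.
  (* Each value of [phi f] is a value of [f], so the threshold [M] for [f] still works. *)
  by exists M; split=> // N /fM fN x _; exact: fN.
(* Both suprema are over the same set: the value at [z] in [X] is that of [f] at [r z], and the
   value of [f] at [z] in [A] is attained at [set_val z], which [r] sends back to [z]. *)
congr sup; apply/seteqP; split=> _ [z _ <-] /=; first by exists (insubd a0 z).
by exists (set_val z) => //=; rewrite valKd.
Qed.
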